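(* For $\varepsilon>0$ let $u_\varepsilon(x,t)=(x^2+\varepsilon^2)^{-1/2}$, $(x,t)\in\mathbb{R}\times[0,\infty)$. (For every $c\neq0$, $u_\varepsilon$ is a solution of $\frac1c\partial_t u_\varepsilon+\partial_x u_\varepsilon+x\,u_\varepsilon^3=0$, $u_\varepsilon(x,0)=(x^2+\varepsilon^2)^{-1/2}$.) The $\mathcal{G}^\infty$-singular support of the net $(u_\varepsilon)_{\varepsilon>0}$ is $\{(0,t):t\ge 0\}$.
   Context: Let $\Omega$ be an open subset of $\mathbb{R}^n$ or the closure of one (here $\Omega=\mathbb{R}\times[0,\infty)$). A net $(u_\varepsilon)_{\varepsilon>0}$ of smooth functions on $\Omega$ is moderate if for all compact $K\subset\Omega$ and all multi-indices $\alpha\in\mathbb{N}_0^n$ there exists $b\ge0$ such that $\sup_{y\in K}|\partial^\alpha u_\varepsilon(y)|=O(\varepsilon^{-b})$ as $\varepsilon\to0$. It has the $\mathcal{G}^\infty$-property on $\Omega$ if for all compact $K\subset\Omega$ there is $b\ge 0$ such that for all multi-indices $\alpha\in\mathbb{N}_0^n$, $\sup_{y\in K}|\partial^\alpha u_\varepsilon(y)|=O(\varepsilon^{-b})$ as $\varepsilon\to0$ (the same $b$ for all $\alpha$). The $\mathcal{G}^\infty$-singular support of a moderate net $(u_\varepsilon)_{\varepsilon>0}$ on $\Omega$ is the complement in $\Omega$ of the largest (relatively) open subset $\omega\subset\Omega$ such that $(u_\varepsilon|_\omega)_{\varepsilon>0}$ has the $\mathcal{G}^\infty$-property on $\omega$.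 *)

(* Defs.v *)
From HB Require Import structures.
From mathcomp Require Import all_boot all_order all_algebra.
From mathcomp Require Import all_classical all_reals all_analysis.

Set Implicit Arguments.
Unset Strict Implicit.
Unset Printing Implicit Defensive.

Import Order.TTheory GRing.Theory Num.Theory.
Import numFieldNormedType.Exports.

Local Open Scope classical_set_scope.
Local Open Scope ring_scope.

Section GInfty.
Context {R : realType} {n : nat}.
Implicit Types (Omega omega K : set 'rV[R]_n) (f : 'rV[R]_n -> R).

(* The leftmost index of s is differentiated last. *)
Definition pderivs (s : seq 'I_n) f : 'rV[R]_n -> R :=
  foldr (fun i g x => 'D_(delta_mx 0 i) g x) f s.

(* Omega need not be open: the derivatives are computed in the interior of
   Omega and extended to the points of Omega by continuity. This is meaningful
   as soon as Omega is contained in the closure of its interior, which is the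
   case for open sets, closures of open sets, and relatively open subsets of
   these. *)
Definition pderivs_on Omega (s : seq 'I_n) f (x : 'rV[R]_n) : R :=
  lim (pderivs s f y @[y --> within Omega° (nbhs x)]).

Definition smooth_on Omega f : Prop :=
  [/\ (forall s i x, Omega° x -> derivable (pderivs s f) x (delta_mx 0 i)),
      (forall s x, Omega° x -> {for x, continuous (pderivs s f)}),
      (forall s x, Omega x ->
         cvg (pderivs s f y @[y --> within Omega° (nbhs x)])) &
      {within Omega, continuous f}].

(* A multi-index alpha, listed as 0 repeated alpha 0 times, then 1 repeated
   alpha 1 times, and so on; for smooth functions the order is irrelevant. *)
Definition multi_seq (alpha : 'I_n -> nat) : seq 'I_n :=
  flatten [seq nseq (alpha i) i | i <- enum 'I_n].

Definition mderiv_on Omega (alpha : 'I_n -> nat) f : 'rV[R]_n -> R :=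
  pderivs_on Omega (multi_seq alpha) f.

(* Nets are families indexed by R of which only the members with positive index
   matter. *)
Definition smooth_net Omega (u : R -> 'rV[R]_n -> R) : Prop :=
  forall eps, 0 < eps -> smooth_on Omega (u eps).

Definition sup_mderiv Omega K alpha (u : R -> 'rV[R]_n -> R) (eps : R) : R :=
  sup [set `|mderiv_on Omega alpha (u eps) y| | y in K].

Local Notation right0 := (at_right (0 : R)).

Definition moderate Omega (u : R -> 'rV[R]_n -> R) : Prop :=
  smooth_net Omega u /\
  forall K, compact K -> K `<=` Omega ->
  forall alpha : 'I_n -> nat, exists2 b : R, 0 <= b &
    sup_mderiv Omega K alpha u =O_ right0 (fun eps => eps `^ (- b)).

Definition Ginfty_property Omega (u : R -> 'rV[R]_n -> R) : Prop :=
  smooth_net Omega u /\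
  forall K, compact K -> K `<=` Omega -> exists2 b : R, 0 <= b &
    forall alpha : 'I_n -> nat,
    sup_mderiv Omega K alpha u =O_ right0 (fun eps => eps `^ (- b)).

Definition relatively_open Omega omega : Prop :=
  exists2 U : set 'rV[R]_n, open U & omega = Omega `&` U.

Definition largest_Ginfty_subset Omega (u : R -> 'rV[R]_n -> R) omega : Prop :=
  [/\ relatively_open Omega omega, Ginfty_property omega u &
      forall omega', relatively_open Omega omega' ->
        Ginfty_property omega' u -> omega' `<=` omega].

Definition is_Ginfty_singsupp Omega (u : R -> 'rV[R]_n -> R)
    (S : set 'rV[R]_n) : Prop :=
  exists2 omega, largest_Ginfty_subset Omega u omega & S = Omega `\` omega.

End GInfty.

(* Points of the plane are row vectors p, with p 0 0 = x and p 0 1 = t. *)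
Definition half_plane (R : realType) : set 'rV[R]_2 := [set p | 0 <= p 0 1].

Definition u_net (R : realType) (eps : R) (p : 'rV[R]_2) : R :=
  (p 0 0 ^+ 2 + eps ^+ 2) `^ (- 2^-1).

(* Main.v *)
(** The net depends on x only, through w = (x^2 + eps^2)^(-1/2). Since
    w <= 1/eps and |x| w <= 1, the three-term recursion for the derivatives of
    w gives |w^(k)| <= A_k w^(k+1) with A_k independent of x and eps. Hence the
    net is moderate, and on a compact set that avoids x = 0 all derivatives are
    bounded uniformly in eps, because w <= 1/|x|. At x = 0 the recursion reads
    w^(k+2) = - (k+1)^2 eps^(-2) w^(k), so |w^(2m)(0)| >= eps^(-2m-1) and no
    single exponent controls all orders near a point with x = 0. *)

Require Import Defs.
From HB Require Import structures.
From mathcomp Require Import all_boot all_order all_algebra.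
From mathcomp Require Import all_classical all_reals all_analysis.
From mathcomp Require Import ring lra.

Set Implicit Arguments.
Unset Strict Implicit.
Unset Printing Implicit Defensive.

Import Order.TTheory GRing.Theory Num.Theory.
Import numFieldNormedType.Exports.

Local Open Scope classical_set_scope.
Local Open Scope ring_scope.

(** * One-variable profile: derivatives, upper bounds, values at the origin *)

Section Profile.
Context {R : realType}.
Implicit Types (eps x : R) (k : nat).

Definition profile eps x : R := (x ^+ 2 + eps ^+ 2) `^ (- 2^-1).

(* The recursion is the Leibniz rule applied to
   (x^2 + eps^2) w' + x w = 0, solved for the highest derivative. *)
Fixpoint profile_deriv eps k x : R :=
  match k with
  | 0 => profile eps x
  | k1.+1 => match k1 with
    | 0 => - x * profile eps x ^+ 3
    | k2.+1 => - profile eps x ^+ 2 *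
        ((2 * k2 + 3)%:R * x * profile_deriv eps k1 x
         + (k2.+1 ^ 2)%:R * profile_deriv eps k2 x)
    end
  end.

Lemma profile_gt0 eps x : 0 < eps -> 0 < profile eps x.
Proof. by move=> e0; rewrite powR_gt0 // ltr_wpDl ?sqr_ge0 ?exprn_gt0. Qed.

Lemma profile_sqr eps x : 0 < eps ->
  profile eps x ^+ 2 * (x ^+ 2 + eps ^+ 2) = 1.
Proof.
move=> e0; have s0 : 0 < x ^+ 2 + eps ^+ 2.
  by rewrite ltr_wpDl ?sqr_ge0 ?exprn_gt0.
rewrite /profile powRN powR12_sqrt ?ltW // exprVn sqr_sqrtr ?ltW //.
by rewrite mulVf ?gt_eqF.
Qed.

Lemma profile0 eps : 0 < eps -> profile eps 0 = eps^-1.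
Proof.
move=> e0; rewrite /profile expr0n add0r powRN powR12_sqrt ?sqr_ge0 //.
by rewrite sqrtr_sqr gtr0_norm.
Qed.

Lemma profile_mul_le1 eps x : 0 < eps ->
  eps * profile eps x <= 1 /\ `|x| * profile eps x <= 1.
Proof.
move=> e0; have w0 := profile_gt0 x e0; have w2 := profile_sqr x e0.
(* Comparing squares reduces both bounds to [profile_sqr]; [a] will be [eps] and [|x|]. *)
have le1 a : 0 <= a -> a ^+ 2 <= x ^+ 2 + eps ^+ 2 -> a * profile eps x <= 1.
  move=> a0 ha; rewrite -(@expr_le1 _ 2) ?(mulr_ge0 _ (ltW w0)) //.
  by rewrite exprMn mulrC -w2 ler_wpM2l ?sqr_ge0.
split; apply: le1; rewrite ?(ltW e0) ?lerDr ?sqr_ge0 //.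
by rewrite real_normK ?num_real // lerDl sqr_ge0.
Qed.

Lemma is_derive_profile eps x : 0 < eps ->
  is_derive x 1 (profile eps) (- x * profile eps x ^+ 3).
Proof.
move=> e0; have s0 : 0 < x ^+ 2 + eps ^+ 2.
  by rewrite ltr_wpDl ?sqr_ge0 ?exprn_gt0.
have h : is_derive x 1 (fun y : R => y ^+ 2 + eps ^+ 2) (2 * x).
  have -> : (fun y : R => y ^+ 2 + eps ^+ 2)
    = (@id R) ^+ 2 + cst (eps ^+ 2) by [].
  by apply: is_derive_eq; rewrite addr0 /GRing.scale /= mulr1 expr1.
have h2 := is_derive1_powR (- 2^-1) s0.
have := @is_derive1_comp _ _ (fun y : R => y ^+ 2 + eps ^+ 2) _ _ _ h2 h.
rewrite /comp -/(profile eps) => h3.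
apply: is_derive_eq; have w2 := profile_sqr x e0.
(* The exponent -1/2 - 1 is split; since (x^2 + eps^2)^-1 = w^2, the power becomes w^3. *)
rewrite powRD; last first.
  by apply/implyP => _; rewrite gt_eqF.
rewrite powR_inv1 ?ltW // -/(profile eps x).
have -> : (x ^+ 2 + eps ^+ 2)^-1 = profile eps x ^+ 2.
  by rewrite -[LHS]mul1r -w2 mulfK // gt_eqF.
by field.
Qed.

(** The recursion goes back two orders, so two consecutive orders are carried through the
    induction. *)
Lemma is_derive_profile_deriv eps k x : 0 < eps ->
  is_derive x 1 (profile_deriv eps k) (profile_deriv eps k.+1 x).
Proof.
move=> e0; suff : forall k (y : R),
    is_derive y 1 (profile_deriv eps k) (profile_deriv eps k.+1 y) /\
    is_derive y 1 (profile_deriv eps k.+1) (profile_deriv eps k.+2 y).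
  by move=> /(_ k x)[].
move=> {}k {}x.
have W y := is_derive_profile y e0.
elim: k => [|k IH].
  split; first exact: W.
  have -> : profile_deriv eps 1 = - (@id R) * profile eps ^+ 3 by [].
  apply: is_derive_eq.
  rewrite /= /GRing.scale /= !fctE /=; ring.
have [d0 d1] := IH; split; first exact: d1.
have -> : profile_deriv eps k.+2 =
   - (profile eps ^+ 2) * ((2 * k + 3)%:R *: (@id R * profile_deriv eps k.+1)
         + (k.+1 ^ 2)%:R *: profile_deriv eps k).
  apply/funext => y /=; rewrite !fctE /GRing.scale /= !mulrA; ring.
apply: is_derive_eq.
rewrite /= /GRing.scale /= !fctE /=.
(* Here [b] is w^(k+1). Differentiating the factor w^2 gives -2 x w^2 w^(k+2), which turns 2k+3 into
   2k+5; moreover (k+1)^2 + (2k+3) = (k+2)^2. *)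
set w := profile eps x; set b := (match k with 0 => _ | _.+1 => _ end).
set a := profile_deriv eps k x.
rewrite /GRing.scale /=; ring.
Qed.

Lemma profile_deriv_bound k : exists2 A : R, 0 <= A & forall eps x, 0 < eps ->
  `|profile_deriv eps k x| <= A * profile eps x ^+ k.+1.
Proof.
suff : (exists2 A : R, 0 <= A & forall eps x, 0 < eps ->
    `|profile_deriv eps k x| <= A * profile eps x ^+ k.+1) /\
  (exists2 A : R, 0 <= A & forall eps x, 0 < eps ->
    `|profile_deriv eps k.+1 x| <= A * profile eps x ^+ k.+2) by case.
elim: k => [|k [[A A0 hA] [B B0 hB]]].
  split; exists 1 => // eps x e0; have w0 := profile_gt0 x e0.
    by rewrite mul1r expr1 /= gtr0_norm.
  have [_ h] := profile_mul_le1 x e0.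
  rewrite /= normrM normrN mul1r (gtr0_norm (exprn_gt0 _ w0)) exprS mulrA.
  by rewrite ler_piMl // exprn_ge0 // ltW.
split; first by exists B.
exists ((2 * k + 3)%:R * B + (k.+1 ^ 2)%:R * A).
  by rewrite addr_ge0 ?mulr_ge0.
move=> eps x e0; have w0 := profile_gt0 x e0.
have [_ h] := profile_mul_le1 x e0.
have /= := hA eps x e0; have /= := hB eps x e0.
set b := (match k with 0 => _ | _.+1 => _ end).
set a := profile_deriv eps k x; set w := profile eps x => hb ha.
rewrite normrM normrN (gtr0_norm (exprn_gt0 _ w0)).
have -> : ((2 * k + 3)%:R * B + (k.+1 ^ 2)%:R * A) * w ^+ k.+3 =
  w ^+ 2 * ((2 * k + 3)%:R * (B * w ^+ k.+1) + (k.+1 ^ 2)%:R * (A * w ^+ k.+1)).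
  by rewrite !exprS; ring.
rewrite ler_wpM2l ?exprn_ge0 ?(ltW w0) // (le_trans (ler_normD _ _)) // lerD //.
  rewrite !normrM ger0_norm // -mulrA ler_wpM2l //.
  (* The bound on w^(k+1) has one power of w to spare, which absorbs [|x|]. *)
  apply: (@le_trans _ _ (`|x| * (B * w ^+ k.+2))); first by rewrite ler_wpM2l.
  have -> : `|x| * (B * w ^+ k.+2) = `|x| * w * (B * w ^+ k.+1).
    by rewrite [w ^+ k.+2]exprS; ring.
  by rewrite ler_piMl // mulr_ge0 // exprn_ge0 // ltW.
by rewrite normrM ger0_norm // ler_wpM2l.
Qed.

Lemma profile_deriv_even_at0 eps m : 0 < eps ->
  eps^-1 ^+ (2 * m).+1 <= `|profile_deriv eps (2 * m) 0|.
Proof.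
move=> e0; elim: m => [|m IH].
  by rewrite muln0 expr1 /= profile0 // gtr0_norm ?invr_gt0.
have -> : (2 * m.+1)%N = (2 * m).+2 by rewrite mulnS.
rewrite /= mulr0 mul0r add0r profile0 // normrM normrN exprSr exprSr.
rewrite -mulrA -expr2 mulrC (gtr0_norm (exprn_gt0 _ _)) ?invr_gt0 //.
rewrite ler_wpM2l ?exprn_ge0 ?invr_ge0 ?(ltW e0) // normrM ger0_norm //.
(* Of the integer factor (2m+1)^2 only its being at least 1 is kept. *)
apply: (le_trans IH); rewrite ler_peMl // ler1n expn_gt0 //.
Qed.

End Profile.

(** * Partial derivatives of functions of x alone *)

Section PlaneNet.
Context {R : realType}.
Implicit Types (eps : R) (p : 'rV[R]_2).

(** The difference quotients agree before any limit is taken, so [g] may be arbitrary. *)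
Lemma derive_coord0 (g : R -> R) (i : 'I_2) p :
  'D_(delta_mx 0 i) (fun q : 'rV[R]_2 => g (q 0 0)) p
  = if i == 0 then 'D_1 g (p 0 0) else 0.
Proof.
case: ifP => [/eqP ->|i0]; rewrite /derive.
  congr (lim (_ @ 0^')); apply/funext => h /=.
  by rewrite /GRing.scale /= !mxE !eqxx.
rewrite (_ : (fun h => _) = cst 0) ?lim_cst //.
apply/funext => h /=.
by rewrite !mxE eq_sym i0 andbF mulr0 add0r subrr scaler0.
Qed.

Lemma derivable_coord0 (g : R -> R) (i : 'I_2) p : derivable g (p 0 0) 1 ->
  derivable (fun q : 'rV[R]_2 => g (q 0 0)) p (delta_mx 0 i).
Proof.
have [-> dg|i0 _] := eqVneq i 0; rewrite /derivable.
  rewrite (_ : (fun h => _) =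
    (fun h => h^-1 *: (g (h *: 1 + p 0 0) - g (p 0 0)))) //.
  by apply/funext => h /=; rewrite /GRing.scale /= !mxE !eqxx.
rewrite (_ : (fun h => _) = cst 0); first exact: is_cvg_cst.
apply/funext => h /=.
by rewrite !mxE eq_sym (negbTE i0) andbF mulr0 add0r subrr scaler0.
Qed.

Lemma pderivs_u_net eps (s : seq 'I_2) : 0 < eps ->
  pderivs s (u_net eps) =
  (fun p => if 1 \in s then 0 else profile_deriv eps (size s) (p 0 0)).
Proof.
move=> e0; elim: s => [|i s IH]; first by apply/funext.
rewrite [LHS]/= IH; apply/funext => p; rewrite in_cons.
case: (boolP (1 \in s)) => s1.
  by rewrite orbT (derive_coord0 (cst 0)) derive_cst if_same.
rewrite orbF (derive_coord0 (profile_deriv eps (size s))).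
have D := @is_derive_profile_deriv _ eps (size s) (p 0 0) e0.
by case: i => [[|[|//]]] h; last first; rewrite ?derive_val.
Qed.

Lemma derivable_pderivs_u_net eps s (i : 'I_2) p : 0 < eps ->
  derivable (pderivs s (u_net eps)) p (delta_mx 0 i).
Proof.
move=> e0; rewrite pderivs_u_net //; case: (1 \in s).
  exact: derivable_cst.
apply: (@derivable_coord0 (profile_deriv eps (size s))).
by have D := @is_derive_profile_deriv _ eps (size s) (p 0 0) e0.
Qed.

Lemma continuous_pderivs_u_net eps s : 0 < eps ->
  continuous (pderivs s (u_net eps)).
Proof.
move=> e0 p; rewrite pderivs_u_net //; case: (1 \in s).
  exact: cst_continuous.
apply: (@continuous_comp _ _ _ (fun q : 'rV[R]_2 => q 0 0)
  (profile_deriv eps (size s))); first exact: coord_continuous.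
apply/differentiable_continuous/derivable1_diffP.
by have D := @is_derive_profile_deriv _ eps (size s) (p 0 0) e0.
Qed.

End PlaneNet.

(** * Derivatives on relatively open sets, suprema, multi-indices *)

Section RelativelyOpen.
Context {R : realType}.
Implicit Types (eps : R) (p : 'rV[R]_2) (omega : set 'rV[R]_2).

(** A small shift of [p] in the positive t-direction stays in [U] and enters t > 0. This makes the
    filter in [pderivs_on] proper, hence its limit unique. *)
Lemma closure_interior_half_plane omega p :
  relatively_open (@half_plane R) omega -> omega p -> closure omega° p.
Proof.
move=> [U oU ->] [Hp Up] B Bp.
have c : {for 0, continuous (fun r : R => p + r *: delta_mx 0 1)}.
  move=> /=; apply: cvgD; first exact: cvg_cst.
  by apply: cvgZl; exact: cvg_id.
have nUB : nbhs (p + 0 *: delta_mx 0 1 : 'rV[R]_2) (U `&` B).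
  by rewrite scale0r addr0; apply: filterI => //; exact: open_nbhs_nbhs.
have nr : \forall r \near 0^'+, (U `&` B) (p + r *: delta_mx 0 1) /\ 0 < r.
  apply: filterI; last exact: nbhs_right_gt.
  exact: (@cvg_within _ (nbhs (0 : R)) _ _ _ (c _ nUB)).
case: (filter_ex nr) => r [[Ur Br] r0].
exists (p + r *: delta_mx 0 1); split => //.
have oP : open ([set q : 'rV[R]_2 | 0 < q 0 1] `&` U).
  apply: openI => //.
  apply: (@open_comp _ _ (fun q : 'rV[R]_2 => q 0 1) [set x | 0 < x]).
    by move=> q _; exact: coord_continuous.
  exact: open_gt.
move: (oP); rewrite openE; move=> /(_ (p + r *: delta_mx 0 1)) oP'.
apply: (interiorS _ (oP' _)) => [q [q0 Uq]|]; first by split => //; exact: ltW.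
by split => //; rewrite /= !mxE !eqxx mulr1 ltr_wpDl.
Qed.

(** The derivatives are continuous on the whole plane, so the limit from the interior is the value
    at [p]. *)
Lemma pderivs_on_u_net omega eps s p :
  relatively_open (@half_plane R) omega -> 0 < eps -> omega p ->
  pderivs_on omega s (u_net eps) p =
  if 1 \in s then 0 else profile_deriv eps (size s) (p 0 0).
Proof.
move=> om e0 op.
have pf : ProperFilter (within omega° (nbhs p)).
  exact/within_nbhs_proper/closure_interior_half_plane.
have /cvg_lim h : pderivs s (u_net eps) x @[x --> within omega° (nbhs p)]
    --> pderivs s (u_net eps) p.
  by apply: cvg_within_filter; exact: continuous_pderivs_u_net.
by rewrite /pderivs_on h // pderivs_u_net.
Qed.

Lemma smooth_on_u_net omega eps : 0 < eps -> smooth_on omega (u_net eps).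
Proof.
move=> e0; split.
- by move=> s i x _; exact: derivable_pderivs_u_net.
- by move=> s x _; exact: continuous_pderivs_u_net.
- move=> s x _; apply/cvg_ex; exists (pderivs s (u_net eps) x).
  by apply: cvg_within_filter; exact: continuous_pderivs_u_net.
- by apply: continuous_subspaceT; exact: (@continuous_pderivs_u_net _ eps [::]).
Qed.

Lemma sup_normr_le (T : Type) (K : set T) (f : T -> R) (C : R) :
  0 <= C -> (forall y, K y -> `|f y| <= C) ->
  `|sup [set `|f y| | y in K]| <= C.
Proof.
(* By convention the [sup] of the empty set is 0. *)
move=> C0 fC; have [->|/set0P[y Ky]] := eqVneq K set0.
  by rewrite image_set0 sup0 normr0.
have ub : ubound [set `|f y| | y in K] C by move=> _ [z Kz <-]; exact: fC.
rewrite ger0_norm.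
  by apply: ge_sup => //; exists `|f y|, y.
apply: (@le_trans _ _ `|f y|) => //.
by apply: ub_le_sup; [exists C|exists y].
Qed.

Lemma sup_normr_set1 (T : Type) (y : T) (f : T -> R) :
  sup [set `|f z| | z in [set y]] = `|f y|.
Proof. by rewrite image_set1 sup1. Qed.

Lemma count_multi_seq n (alpha : 'I_n -> nat) i :
  count_mem i (multi_seq alpha) = alpha i.
Proof.
rewrite /multi_seq count_flatten -map_comp sumnE big_map big_enum /=.
rewrite (bigD1 i) //= count_nseq /= eqxx mul1n big1 ?addn0 // => j ji.
by rewrite count_nseq /= (negbTE ji).
Qed.

Lemma size_multi_seq n (alpha : 'I_n -> nat) :
  size (multi_seq alpha) = (\sum_i alpha i)%N.
Proof.
rewrite /multi_seq size_flatten /shape -map_comp sumnE big_map big_enum /=.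
by apply: eq_bigr => i _; rewrite size_nseq.
Qed.

End RelativelyOpen.

(** * Moderateness and the singular support *)

Section Singsupp.
Context {R : realType}.
Implicit Types (eps : R) (p : 'rV[R]_2) (K omega : set 'rV[R]_2).

(** Serves twice: with [B] = 1/eps for moderateness, and with [B] independent of eps away from x =
    0. *)
Lemma sup_mderiv_u_net_bound omega (alpha : 'I_2 -> nat) :
  relatively_open (@half_plane R) omega ->
  exists2 A : R, 0 < A & forall K eps (B : R), K `<=` omega -> 0 < eps ->
    0 <= B -> (forall y, K y -> profile eps (y 0 0) <= B) ->
    `|sup_mderiv omega K alpha (@u_net R) eps|
    <= A * B ^+ (size (multi_seq alpha)).+1.
Proof.
move=> om; have [A A0 hA] := @profile_deriv_bound R (size (multi_seq alpha)).
(* [A] may be 0, whereas a big-O constant must be positive. *)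
exists (A + 1) => [|K eps B Ko e0 B0 hB]; first by rewrite ltr_wpDl.
apply: sup_normr_le => [|y Ky].
  by rewrite mulr_ge0 ?exprn_ge0 // addr_ge0.
rewrite /mderiv_on pderivs_on_u_net //; last exact: Ko.
have A1 : A <= A + 1 by rewrite lerDl.
case: ifP => _; first by rewrite normr0 mulr_ge0 ?exprn_ge0 // addr_ge0.
apply: (le_trans (hA eps (y 0 0) e0)); apply: ler_pM => //.
  by rewrite exprn_ge0 // ltW // profile_gt0.
by rewrite lerXn2r ?nnegrE ?hB // ltW // profile_gt0.
Qed.

Lemma relatively_open_half_plane :
  relatively_open (@half_plane R) (@half_plane R).
Proof. by exists setT; [exact: openT|rewrite setIT]. Qed.

Lemma moderate_u_net : moderate (@half_plane R) (@u_net R).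
Proof.
split=> [eps e0|K _ KH alpha]; first exact: smooth_on_u_net.
have [A A0 hA] := sup_mderiv_u_net_bound alpha relatively_open_half_plane.
exists (size (multi_seq alpha)).+1%:R => //; apply/eqO_exP; exists A => //.
near=> eps; have e0 : 0 < eps by near: eps; exact: nbhs_right_gt.
rewrite powRN powR_mulrn ?(ltW e0) // normfV normrX gtr0_norm // -exprVn.
apply: hA => // [|y _]; first by rewrite invr_ge0 ltW.
rewrite -[leRHS]mulr1 -ler_pdivrMl ?invr_gt0 // invrK.
by have [] := profile_mul_le1 (y 0 0) e0.
Unshelve. all: by end_near. Qed.

(** The candidate for the largest subset with the G-infinity property. *)
Let off_axis : set 'rV[R]_2 := @half_plane R `&` [set p | p 0 0 != 0].

Lemma relatively_open_off_axis : relatively_open (@half_plane R) off_axis.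
Proof.
exists [set p | p 0 0 != 0] => //.
apply: (@open_comp _ _ (fun q : 'rV[R]_2 => q 0 0) [set x | x != 0]).
  by move=> q _; exact: coord_continuous.
exact: open_neq.
Qed.

Lemma Ginfty_off_axis : Ginfty_property off_axis (@u_net R).
Proof.
split=> [eps e0|K cK KO]; first exact: smooth_on_u_net.
exists 0 => // alpha.
have [A A0 hA] := sup_mderiv_u_net_bound alpha relatively_open_off_axis.
(* 1/x is continuous on the compact [K], hence bounded there, and w <= 1/|x|. *)
have [B B0 hB] : exists2 B : R, 0 < B & forall y, K y -> `|(y 0 0)^-1| <= B.
  have ci : {within K, continuous (fun y : 'rV[R]_2 => (y 0 0)^-1)}.
    apply: continuous_in_subspaceT => y /set_mem /KO[_ y0].
    apply: (@continuous_comp _ _ _ (fun q : 'rV[R]_2 => q 0 0) (@GRing.inv R)).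
      exact: coord_continuous.
    exact: inv_continuous.
  have [M [_ hM]] := compact_bounded (continuous_compact ci cK).
  exists (`|M| + 1) => [|y Ky]; first by rewrite ltr_wpDl.
  by apply: hM; [rewrite (le_lt_trans (ler_norm M)) // ltrDl|exists y].
apply/eqO_exP; exists (A * B ^+ (size (multi_seq alpha)).+1).
  by rewrite mulr_gt0 // exprn_gt0.
near=> eps; have e0 : 0 < eps by near: eps; exact: nbhs_right_gt.
rewrite oppr0 powRr0 normr1 mulr1; apply: hA => //; first exact: ltW.
move=> y Ky; apply: le_trans (hB _ Ky); have [_ y0] := KO _ Ky.
rewrite normfV -[leRHS]mulr1 -ler_pdivrMl ?invr_gt0 ?normr_gt0 // invrK.
by have [] := profile_mul_le1 (y 0 0) e0.
Unshelve. all: by end_near. Qed.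

(* On the singleton {p} with p 0 0 = 0, the x-derivative of order 2 m has size
   at least eps^-(2 m + 1), so no exponent b serves all orders. *)
Lemma Ginfty_sub_off_axis omega : relatively_open (@half_plane R) omega ->
  Ginfty_property omega (@u_net R) -> omega `<=` off_axis.
Proof.
move=> om [_ G] p op; split; first by case: om op => U _ -> [].
apply/negP => /eqP p0.
have [|b b0 hb] := G [set p] (@compact_set1 _ p); first by move=> _ ->.
pose n := Num.bound b.
have /ltW bn : b < n%:R by have := archi_boundP b0.
pose alpha (i : 'I_2) := if i == 0 then (2 * n)%N else 0%N.
have [k k0] := (eqO_exP _ _ _).1 (hb alpha) => hk.
(* One small eps violating the bound is enough: the filter of right neighbourhoods of 0 is
   proper. *)
suff : \forall eps \near (0 : R)^'+, False by move=> /filter_ex[].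
near=> eps.
have e0 : 0 < eps by near: eps; exact: nbhs_right_gt.
have e1 : eps < 1 by near: eps; exact: nbhs_right_lt.
have ek : eps < k^-1 by near: eps; apply: nbhs_right_lt; rewrite invr_gt0.
have : `|sup_mderiv omega [set p] alpha (@u_net R) eps| <= k * `|eps `^ (- b)|.
  by near: eps.
rewrite /sup_mderiv sup_normr_set1 normr_id /mderiv_on pderivs_on_u_net //.
rewrite -has_pred1 has_count count_multi_seq size_multi_seq /=.
rewrite big_ord_recl big_ord1 /= addn0 p0.
move=> /(le_trans (profile_deriv_even_at0 n e0)).
apply/negP; rewrite -ltNge.
have i1 : 1 <= eps^-1 by rewrite invf_ge1 // ltW.
have ebn : eps `^ (- b) <= eps^-1 ^+ n.
  by rewrite exprVn -(powR_invn _ (ltW e0)) ger_powR ?lerN2 // e0 ltW.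
rewrite ger0_norm ?powR_ge0 //.
apply: (@le_lt_trans _ _ (k * eps^-1 ^+ n)); first by rewrite ler_wpM2l // ltW.
(* Since b < n, [n] of the powers of 1/eps absorb eps^(-b); the remaining n+1 amount to at least
   1/eps, which exceeds the big-O constant [k]. *)
have -> : (2 * n).+1 = (n + n.+1)%N by rewrite addnS mul2n addnn.
rewrite exprD mulrC ltr_pM2l ?exprn_gt0 ?invr_gt0 //.
apply: (@lt_le_trans _ _ eps^-1).
  by rewrite -ltf_pV2 ?posrE ?invr_gt0 // invrK.
by rewrite exprS ler_peMr ?invr_ge0 ?(ltW e0) // exprn_ege1.
Unshelve. all: by end_near. Qed.

Lemma is_Ginfty_singsupp_u_net : is_Ginfty_singsupp (@half_plane R) (@u_net R)
  [set p : 'rV[R]_2 | p 0 0 = 0 /\ 0 <= p 0 1].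
Proof.
exists off_axis.
  split; [exact: relatively_open_off_axis|exact: Ginfty_off_axis|].
  exact: Ginfty_sub_off_axis.
apply/seteqP; split=> p /=.
  by move=> [p0 p1]; split => //; rewrite /off_axis /= p0 eqxx => -[].
move=> [p1 np]; split => //; apply/eqP/negPn/negP => p0.
by apply: np; split.
Qed.

(** The t-derivative vanishes, and the x-derivative -x w^3 cancels the cubic term. *)
Lemma u_net_equation (c eps : R) p : 0 < eps -> half_plane p ->
  c^-1 * pderivs_on (@half_plane R) [:: 1] (u_net eps) p
  + pderivs_on (@half_plane R) [:: 0] (u_net eps) p
  + p 0 0 * u_net eps p ^+ 3 = 0.
Proof.
move=> e0 Hp; have H := relatively_open_half_plane.
rewrite !pderivs_on_u_net // !inE /= mulr0 add0r.
by rewrite -[u_net eps p]/(profile eps (p 0 0)) mulNr addNr.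
Qed.

End Singsupp.

Theorem proposition6p3 (R : realType) :
  [/\ (forall c eps : R, c != 0 -> 0 < eps ->
         (forall p : 'rV[R]_2, half_plane p ->
            c^-1 * pderivs_on (@half_plane R) [:: 1] (u_net eps) p
            + pderivs_on (@half_plane R) [:: 0] (u_net eps) p
            + p 0 0 * u_net eps p ^+ 3 = 0) /\
         (forall p : 'rV[R]_2, p 0 1 = 0 ->
            u_net eps p = (p 0 0 ^+ 2 + eps ^+ 2) `^ (- 2^-1))),
      moderate (@half_plane R) (@u_net R) &
      is_Ginfty_singsupp (@half_plane R) (@u_net R)
        [set p : 'rV[R]_2 | p 0 0 = 0 /\ 0 <= p 0 1]].
Proof.
split; [|exact: moderate_u_net|exact: is_Ginfty_singsupp_u_net].
by move=> c eps _ e0; split=> // p Hp; exact: u_net_equation.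
Qed.
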